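(* Let $\alpha\in(0,2]$ and $\beta\in(0,1)$. Let $(\mathsf M,\mathsf d)$ be a metric space with a marked point $o\in\mathsf M$, let $G$ be a group acting on $\mathsf M$, let $(E,\mathcal E,\mu)$ be a $\sigma$-finite measure space, and let $\{A_x\}_{x\in\mathsf M}\subset\mathcal E$ be such that: (i) $\mathsf d(x,y)=\mu(A_x\Delta A_y)$ for all $x,y\in\mathsf M$; (ii) $G$ also acts on $E$ (with $gA\in\mathcal E$ for all $g\in G$, $A\in\mathcal E$), and $A_{g(x)}\Delta A_{g(y)}=g(A_x\Delta A_y)=(gA_x)\Delta(gA_y)$ for all $g\in G$, $x,y\in\mathsf M$; (iii) $\mu$ is $G$-invariant, i.e. $\mu(gA)=\mu(A)$ for all $g\in G$, $A\in\mathcal E$; (iv) $A_o=\emptyset$. Let $\eta_{\alpha,\beta}(x):=Y_{\alpha,\beta}(A_x)$, $x\in\mathsf M$, where $Y_{\alpha,\beta}$ is the set-indexed Karlin stable process associated with $(E,\mathcal E,\mu)$. Then $$\frac{\eta_{\alpha,\beta}(x)-\eta_{\alpha,\beta}(y)}{\mathsf d^{\beta/\alpha}(x,y)}\sim S_\alpha(1,0,0)\qquad\text{for all }x,y\in\mathsf M,\ x\neq y.$$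
   Context: Stable laws: $S_\alpha(\sigma,0,0)$ denotes the symmetric $\alpha$-stable (S$\alpha$S) law with characteristic function $\theta\mapsto\exp(-\sigma^\alpha|\theta|^\alpha)$, for $\alpha\in(0,2]$ (including the Gaussian case $\alpha=2$); $\sigma=0$ gives the point mass at $0$. S$\alpha$S random measure: an S$\alpha$S random measure $M$ with control measure $\kappa$ on a measurable space is a family of random variables $M(B)$, indexed by measurable $B$ with $\kappa(B)<\infty$, such that $M(B)\sim S_\alpha(\kappa(B)^{1/\alpha},0,0)$, the values on pairwise disjoint sets are independent, and $M(\bigcup_iB_i)=\sum_iM(B_i)$ almost surely for disjoint $B_i$ whose union has finite $\kappa$-measure. Write $\int\mathbf 1_B\,dM=M(B)$. Point measures: $\mathbb M_p(E)$ is the space of point measures $m=\sum_i\delta_{x_i}$ (countable sums, $x_i\in E$) on $(E,\mathcal E)$, with the $\sigma$-algebra $\mathcal M_p(E)$ generated by the maps $m\mapsto m(A)$, $A\in\mathcal E$. For $r>0$, $\mathbb P'_{r,\mu}$ is the law on $\mathbb M_p(E)$ of the Poisson point process on $(E,\mathcal E)$ with mean measure $r\mu$. For $\beta\in(0,1)$ define the measure on $\mathbb M_p(E)$ $$\mu_\beta(\cdot):=c_\beta\int_0^\infty r^{-\beta-1}\,\mathbb P'_{r,\mu}(\cdot)\,dr,\qquad c_\beta:=\frac{\beta 2^{1-\beta}}{\Gamma(1-\beta)}.$$ Set-indexed Karlin stable process: let $\mathcal A=\{A\in\mathcal E:\mu(A)<\infty\}$. With $M_{\alpha,\beta}$ an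 S$\alpha$S random measure on $\mathbb M_p(E)$ with control measure $\mu_\beta$, set $$Y_{\alpha,\beta}(A):=\int_{\mathbb M_p(E)}\mathbf 1_{\{m(A)\text{ odd}\}}\,M_{\alpha,\beta}(dm),\qquad A\in\mathcal A.$$ (By (i) and (iv), $\mu(A_x)=\mathsf d(x,o)<\infty$, so $A_x\in\mathcal A$.) $\mathsf d^{\beta/\alpha}(x,y)$ means $(\mathsf d(x,y))^{\beta/\alpha}$, and $\Delta$ denotes symmetric difference. *)

(* Defs.v *)
From HB Require Import structures.
From mathcomp Require Import all_boot all_order all_algebra.
From mathcomp Require Import all_classical all_reals all_analysis.
From mathcomp Require Import measurable_realfun complex.

Set Implicit Arguments.
Unset Strict Implicit.
Unset Printing Implicit Defensive.

Import Order.TTheory GRing.Theory Num.Theory.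
Import numFieldNormedType.Exports.

Local Open Scope classical_set_scope.
Local Open Scope ring_scope.

Definition is_left_action (G : groupType) (S : Type) (act : G -> S -> S) :=
  (forall s, act 1%g s = s) /\
  (forall g h s, act (g * h)%g s = act g (act h s)).

(* X i, i : I, mutually independent under P; the product rule for subfamilies
   is the case where some of the C i are setT. *)
Definition independent_family (R : realType) d (T : measurableType d)
    (P : probability T R) d' (T' : measurableType d') (I : finType)
    (X : I -> T -> T') :=
  forall C : I -> set T', (forall i, measurable (C i)) ->
    P (\bigcap_(i in [set: I]) (X i @^-1` C i)) =
    (\prod_(i : I) fine (P (X i @^-1` C i)))%:E.

Section stable_law.
Context {R : realType}.

Definition characteristic_function (nu : probability R R) (t : R) : R[i] :=
  Complex (\int[nu]_x cos (t * x)) (\int[nu]_x sin (t * x)).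

(* nu = S_alpha(sigma, 0, 0) *)
Definition SaS_law (alpha sigma : R) (nu : probability R R) :=
  forall t : R, characteristic_function nu t =
    (expR (- (sigma `^ alpha * `|t| `^ alpha)))%:C%C.

End stable_law.

(* Random variables are only specified on the B with kappa B < +oo; the values
   of M elsewhere are irrelevant. *)
Record SaS_random_measure (R : realType) d (T : measurableType d)
    (alpha : R) (kappa : set T -> \bar R)
    dO (Omega : measurableType dO) (P : probability Omega R)
    (M : set T -> {RV P >-> R}) : Prop := {
  SaS_rm_law : forall B, measurable B -> (kappa B < +oo)%E ->
    SaS_law alpha (fine (kappa B) `^ alpha^-1) (distribution P (M B)) ;
  SaS_rm_independent : forall n (B : 'I_n -> set T),
    (forall i, measurable (B i)) -> (forall i, (kappa (B i) < +oo)%E) ->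
    trivIset setT B -> independent_family P (fun i => M (B i) : Omega -> R) ;
  SaS_rm_additive : forall B : (set T)^nat,
    (forall i, measurable (B i)) -> trivIset setT B ->
    (kappa (\bigcup_i B i) < +oo)%E ->
    {ae P, forall w,
      (fun n => \sum_(i < n) M (B i) w) @ \oo --> M (\bigcup_i B i) w}
}.

Section point_measures.
Context d (E : measurableType d) (R : realType).

(* Library measures are total on set E, including on non-measurable sets;
   point_measure_out fixes the value there, so that two point measures are
   equal iff they agree on the sigma-algebra of E. The index set D may be
   finite, empty or infinite. *)
Record point_measure : Type := PointMeasure {
  point_measure_val :> {measure set E -> \bar R} ;
  point_measure_dirac : exists (D : set nat) (x : nat -> E),
    forall A, measurable A ->
      point_measure_val A = (\esum_(i in D) \d_(x i) A)%E ;
  point_measure_out : forall A, ~ measurable A -> point_measure_val A = 0%E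
}.

Lemma point_measure_zero_dirac : exists (D : set nat) (x : nat -> E),
  forall A, measurable A ->
    (mzero : {measure set E -> \bar R}) A = (\esum_(i in D) \d_(x i) A)%E.
Proof. by exists set0, (fun=> point) => A _; rewrite esum_set0. Qed.

Definition point_measure_zero : point_measure :=
  PointMeasure point_measure_zero_dirac (fun _ _ => erefl).

HB.instance Definition _ := gen_eqMixin point_measure.
HB.instance Definition _ := gen_choiceMixin point_measure.
HB.instance Definition _ := isPointed.Build point_measure point_measure_zero.

Definition point_measure_evals : set (set point_measure) :=
  \bigcup_(A in @measurable _ E)
    preimage_set_system setT (fun m : point_measure => m A)
      (measurable : set (set (\bar R))).

Definition pmspace : measurableType point_measure_evals.-sigma :=
  g_sigma_algebraType point_measure_evals.

(* Q is the law of the Poisson point process with mean measure nu. (The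
   library's poisson_pmf is not used as it is constantly 1 at rate 0.) *)
Record poisson_process_law (nu : set E -> \bar R)
    (Q : probability pmspace R) : Prop := {
  poisson_law_fin : forall A, measurable A -> (nu A < +oo)%E -> forall k : nat,
    Q [set m : point_measure | m A = k%:R%:E] =
    (fine (nu A) ^+ k / k`!%:R * expR (- fine (nu A)))%:E ;
  poisson_law_infty : forall A, measurable A -> nu A = +oo%E ->
    Q [set m : point_measure | m A = +oo%E] = 1%E ;
  poisson_law_independent : forall n (A : 'I_n -> set E),
    (forall i, measurable (A i)) -> trivIset setT A ->
    independent_family Q (fun i (m : point_measure) => m (A i))
}.

End point_measures.

Section karlin.
Context d (E : measurableType d) (R : realType).

Definition Gamma (x : R) : R :=
  \int[lebesgue_measure]_(t in `]0, +oo[) (t `^ (x - 1) * expR (- t)).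

Definition karlin_cst (beta : R) : R :=
  beta * 2 `^ (1 - beta) / Gamma (1 - beta).

(* mu_beta, where P' r is the law of the Poisson process of mean r mu *)
Definition karlin_measure (beta : R) (P' : R -> probability (pmspace E R) R)
    (B : set (pmspace E R)) : \bar R :=
  ((karlin_cst beta)%:E * \int[lebesgue_measure]_(r in `]0%R, +oo[)
     ((r `^ (- beta - 1))%:E * P' r B))%E.

Definition odd_at (A : set E) : set (pmspace E R) :=
  [set m : point_measure E R | exists2 k : nat, odd k & m A = k%:R%:E].

Definition karlin_process dO (Omega : measurableType dO)
    (P : probability Omega R) (M : set (pmspace E R) -> {RV P >-> R})
    (A : set E) : {RV P >-> R} := M (odd_at A).

End karlin.

(* Main.v *)
Require Import Defs.
From HB Require Import structures.
From mathcomp Require Import all_boot all_order all_algebra.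
From mathcomp Require Import all_classical all_reals all_analysis.
From mathcomp Require Import measurable_realfun.
From mathcomp Require Import ring.
Import Order.TTheory GRing.Theory Num.Theory.
Import numFieldNormedType.Exports.
Local Open Scope classical_set_scope.
Local Open Scope ring_scope.

(** By additivity of the random measure, [eta x - eta y = M (Ox \ Oy) -
    M (Oy \ Ox)] almost surely, where [Oz] is the event that the number of
    points in [A z] is odd. The two terms are independent and symmetric, so the
    difference is stable with scale to the power [alpha] equal to
    [mu_beta (Ox Delta Oy)]. Almost surely [Ox Delta Oy] is the event that
    [A x Delta A y] has an odd number of points, of probability
    [(1 - exp (- 2 r d(x, y))) / 2] under the Poisson process of intensity
    [r mu]; integrating against [c_beta r^(- beta - 1) dr] gives
    [d(x, y)^beta]. *)

Set Implicit Arguments.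
Unset Strict Implicit.

(** * Scaling of Lebesgue integrals, and the integral of r^(-b-1) (1 - e^(-cr)) *)

Lemma lebesgue_measure_scale (R : realType) (c : R) (A : set R) : 0 < c ->
  measurable A ->
  (lebesgue_measure A = c%:E *
    pushforward lebesgue_measure
      (fun x : measurableTypeR R => c * x : measurableTypeR R)%R A)%E.
Proof.
move=> c0 mA; set phi := (X in pushforward _ X).
have mphi : measurable_fun setT phi by exact: measurable_funM.
unshelve epose (pm := pushforward lebesgue_measure phi
  : {measure set (measurableTypeR R) -> \bar R}); first exact: mphi.
(* Both sides are measures in A, so uniqueness of Lebesgue measure reduces the claim to intervals
   []a, b]]. *)
suff mE X : ocitv X -> lebesgue_measure X = mscale (NngNum (ltW c0)) pm X.
  by rewrite (lebesgue_measure_unique mE mA).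
move=> [[a b] _ <-]; rewrite /mscale /=.
have -> : pm `]a, b]%classic = lebesgue_measure `]c^-1 * a, c^-1 * b]%classic.
  congr lebesgue_measure.
  apply/seteqP; split => x; rewrite /phi /= !in_itv /=.
    by rewrite -ltr_pdivrMl// -ler_pdivlMl.
  by rewrite -ltr_pdivrMl// -ler_pdivlMl.
rewrite !lebesgue_measure_itv/= !lte_fin ltr_pM2l ?invr_gt0//.
case: ifPn => _; last by rewrite mule0.
by rewrite -!EFinB -EFinM -mulrBr mulrA divff ?mul1r// gt_eqF.
Qed.

(** Lebesgue measure is c times its image under x -> c x, and the half-line []0, +oo[] is its own
    preimage under this map. *)
Lemma ge0_integral_scale (R : realType) (c : R) (f : R -> \bar R) : 0 < c ->
  measurable_fun (`]0, +oo[%classic : set R) f ->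
  (forall x : R, (0 < x)%R -> 0 <= f x)%E ->
  (\int[lebesgue_measure]_(x in `]0%R, +oo[) f x =
   c%:E * \int[lebesgue_measure]_(x in `]0%R, +oo[) f (c * x)%R)%E.
Proof.
move=> c0 mf f0.
pose phi := (fun x : measurableTypeR R => c * x : measurableTypeR R)%R.
have mphi : measurable_fun setT phi by exact: measurable_funM.
unshelve epose (pm := pushforward lebesgue_measure phi
  : {measure set (measurableTypeR R) -> \bar R}); first exact: mphi.
have pre : phi @^-1` `]0, +oo[%classic = `]0, +oo[%classic.
  by apply/seteqP; split => x; rewrite /phi /= !in_itv /= !andbT pmulr_rgt0.
have f0' (x : R) : `]0, +oo[%classic x -> (0 <= f x)%E.
  by rewrite /= in_itv/= andbT => /f0.
transitivity (\int[mscale (NngNum (ltW c0)) pm]_(x in `]0%R, +oo[) f x)%E.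
  by apply: eq_measure_integral => A mA _; exact: lebesgue_measure_scale.
rewrite ge0_integral_mscale//=; congr (_ * _)%E.
rewrite /pm ge0_integral_pushforward//=; last by move=> x; rewrite inE => /f0'.
by rewrite pre.
Qed.

Lemma powRN_cvgy (R : realType) (b : R) : 0 < b ->
  x `^ (- b) @[x --> +oo] --> (0 : R).
Proof.
move=> b0; apply/cvgr0Pnorm_lt => e e0; near=> x.
have x0 : 0 < x by near: x; exact: nbhs_pinfty_gt.
rewrite ger0_norm ?powR_ge0// powRN invf_plt ?posrE ?powR_gt0//.
rewrite -[ltLHS]powRr1 ?invr_ge0 ?ltW// -[X in _ `^ X](@mulVf _ b) ?gt_eqF//.
rewrite powRrM; apply: gt0_ltr_powR; rewrite ?nnegrE ?powR_ge0 ?(ltW x0)//.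
Unshelve. all: by end_near. Qed.

Lemma continuous_powR (R : realType) (a x : R) : 0 < x ->
  {for x, continuous (fun y : R => y `^ a)}.
Proof.
move=> x0; apply/differentiable_continuous/derivable1_diffP.
by apply: derivable_powR; rewrite in_itv/= x0.
Qed.

(** The antiderivative - y^(-b) / b vanishes at infinity because b > 0. *)
Lemma integral_powR_tail (R : realType) (b s : R) : 0 < b -> 0 < s ->
  (\int[lebesgue_measure]_(x in `]s, +oo[) (x `^ (- b - 1))%:E =
   (b^-1 * s `^ (- b))%:E)%E.
Proof.
move=> b0 s0.
have dF (x : R) : 0 < x ->
    is_derive x 1 (fun y : R => - b^-1 * y `^ (- b)) (x `^ (- b - 1)).
  move=> x0.
  have -> : x `^ (- b - 1) = - b^-1 *: (- b * x `^ (- b - 1)).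
    by rewrite /GRing.scale/= mulrA mulrNN mulVf ?mul1r// gt_eqF.
  exact/is_deriveZ/is_derive1_powR.
rewrite integral_itv_obnd_cbnd; last first.
  by apply/measurable_EFinP; apply: measurable_funTS; exact: measurable_powR.
rewrite (@ge0_continuous_FTC2y _ _ (fun y : R => - b^-1 * y `^ (- b)) s 0).
- by rewrite -EFinB sub0r mulNr opprK.
- by move=> x _; exact: powR_ge0.
- apply: continuous_in_subspaceT => x; rewrite inE/= in_itv/= andbT => sx.
  by apply: continuous_powR; exact: lt_le_trans sx.
- rewrite -(mulr0 (- b^-1)); apply: cvgMr; exact: powRN_cvgy.
- by move=> x sx; have [] := dF x (lt_trans s0 sx).
- apply: cvg_at_right_filter; apply: cvgMr; exact: continuous_powR.
- move=> x; rewrite in_itv/= andbT => sx.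
  by rewrite derive1E; have [_ ->] := dF x (lt_trans s0 sx).
Qed.

(** The integrand is the density of the exponential law of rate c, whose distribution function is
    known; the endpoints carry no mass. *)
Lemma integral_expR_itv (R : realType) (c r : R) : 0 < c -> 0 < r ->
  (\int[lebesgue_measure]_(x in `]0%R, r[) (c * expR (- c * x))%:E =
   (1 - expR (- c * r))%:E)%E.
Proof.
move=> c0 r0; rewrite EFinB -exponential_prob_itv0c//.
rewrite /exponential_prob -integral_itv_obnd_cbnd; last first.
  by apply/measurable_EFinP; apply: measurable_funTS;
    exact: measurable_exponential_pdf.
rewrite -integral_itv_bndo_bndc; last first.
  by apply/measurable_EFinP; apply: measurable_funTS;
    exact: measurable_exponential_pdf.
apply: eq_integral => x; rewrite inE/= in_itv/= => /andP[x0 _].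
by rewrite exponential_pdfE// ltW.
Qed.

Lemma measurable_EFin_powR (R : realType) (a : R) (D : set R) :
  measurable_fun D (fun x : R => (x `^ a)%:E).
Proof.
by apply/measurable_EFinP; apply: measurable_funTS; exact: measurable_powR.
Qed.

Lemma measurable_powR_expR (R : realType) (a c : R) (D : set R) :
  measurable_fun D (fun x : R => (x `^ a * expR (c * x))%:E).
Proof.
apply/measurable_EFinP; apply: measurable_funTS.
apply: measurable_funM; first exact: measurable_powR.
by apply: (measurableT_comp (@measurable_expR R)); exact: measurable_funM.
Qed.

Lemma measurable_Gamma_integrand (R : realType) (b : R) (D : set R) :
  measurable_fun D (fun t : R => (t `^ (- b) * expR (- t))%:E).
Proof.
rewrite (_ : (fun _ => _) =
    (fun t : R => (t `^ (- b) * expR (- 1 * t))%:E)); last first.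
  by apply/funext => t; rewrite mulN1r.
exact: measurable_powR_expR.
Qed.

Lemma measurable_expRM (R : realType) (c : R) (D : set R) :
  measurable_fun D (fun x : R => expR (c * x)).
Proof.
apply: measurable_funTS.
by apply: (measurableT_comp (@measurable_expR R)); exact: measurable_funM.
Qed.

(* [1 - e^{-cr} = \int_0^r c e^{-cs} ds]; integrate over [r > s] first. *)
Lemma integral_powR_onem_expR (R : realType) (b c : R) : 0 < b -> 0 < c ->
  (\int[lebesgue_measure]_(r in `]0%R, +oo[)
     (r `^ (- b - 1) * (1 - expR (- c * r)))%:E =
   (b^-1 * c `^ b)%:E *
   \int[lebesgue_measure]_(t in `]0%R, +oo[) (t `^ (- b) * expR (- t))%:E)%E.
Proof.
move=> b0 c0.
pose f (z : R * R) := z.1 `^ (- b - 1) * (c * expR (- c * z.2)).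
(* With z = (r, s), [h] is the integrand cut off to 0 < s < r and extended by 0, so that Tonelli
   applies on the whole plane. *)
pose h (z : R * R) := if (0 < z.2) && (z.2 < z.1) then f z else 0.
have mf : measurable_fun setT f.
  apply: measurable_funM.
    by apply: (measurableT_comp (measurable_powR _)).
  apply: measurable_funM => //.
  apply: (measurableT_comp (@measurable_expR R)).
  exact: measurable_funM.
have mh : measurable_fun setT h.
  apply: measurable_fun_ifT => //.
  by apply: measurable_and; apply: measurable_fun_ltr.
have h0 z : 0 <= h z.
  rewrite /h /f; case: ifP => // _.
  by rewrite mulr_ge0 ?powR_ge0// mulr_ge0 ?expR_ge0// ltW.
have mEh : measurable_fun setT (EFin \o h) by exact/measurable_EFinP.
have eh0 z : (0 <= (EFin \o h) z)%E by rewrite lee_fin.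
have := @fubini_tonelli _ _ (measurableTypeR R) (measurableTypeR R) R
  lebesgue_measure lebesgue_measure (EFin \o h) mEh eh0.
have -> : (\int[lebesgue_measure]_x \int[lebesgue_measure]_y (EFin \o h) (x, y) =
    \int[lebesgue_measure]_(r in `]0%R, +oo[)
     (r `^ (- b - 1) * (1 - expR (- c * r)))%:E)%E.
  rewrite [RHS]integral_mkcond; apply: eq_integral => r _.
  rewrite patchE; case: ifPn => [|]; rewrite ?inE ?notin_setE /= in_itv/= andbT.
    move=> r0.
    transitivity (\int[lebesgue_measure]_(s in `]0%R, r[)
       ((r `^ (- b - 1))%:E * (c * expR (- c * s))%:E))%E.
      rewrite [RHS]integral_mkcond; apply: eq_integral => s _.
      rewrite patchE /h/= mem_setE in_itv/= (fun_if EFin).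
      by case: ifP => // _; rewrite -EFinM.
    rewrite ge0_integralZl//= ?lee_fin ?powR_ge0//.
    - by rewrite integral_expR_itv.
    - by apply/measurable_EFinP; apply: measurable_funM => //;
        exact: measurable_expRM.
    - by move=> s _; rewrite lee_fin mulr_ge0 ?expR_ge0// ltW.
  move=> /negP; rewrite -leNgt => r0.
  apply: integral0_eq => s _; rewrite /h/=; case: ifP => // /andP[s0 sr].
  by have := lt_le_trans (lt_trans s0 sr) r0; rewrite ltxx.
(* In the other order the section at s > 0 is the ray r > s, and the power tail contributes s^(-b) /
   b. *)
have -> : (\int[lebesgue_measure]_y \int[lebesgue_measure]_x (EFin \o h) (x, y) =
    \int[lebesgue_measure]_(s in `]0%R, +oo[)
     ((b^-1 * c)%:E * (s `^ (- b) * expR (- c * s))%:E))%E.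
  rewrite [RHS]integral_mkcond; apply: eq_integral => s _.
  rewrite patchE; case: ifPn => [|]; rewrite ?inE ?notin_setE /= in_itv/= andbT.
    move=> s0.
    transitivity (\int[lebesgue_measure]_(r in `]s, +oo[)
       ((c * expR (- c * s))%:E * (r `^ (- b - 1))%:E))%E.
      rewrite [RHS]integral_mkcond; apply: eq_integral => r _.
      rewrite patchE /h/= mem_setE in_itv/= andbT s0/= (fun_if EFin).
      by case: ifP => // _; rewrite -EFinM mulrC.
    rewrite ge0_integralZl//= ?lee_fin.
    - rewrite integral_powR_tail// -!EFinM; congr (_%:E); ring.
    - exact: measurable_EFin_powR.
    - by move=> r _; rewrite lee_fin powR_ge0.
    - by rewrite mulr_ge0 ?expR_ge0// ltW.
  move=> /negP s0.
  by apply: integral0_eq => r _; rewrite /h/= (negbTE s0).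
move=> ->.
rewrite ge0_integralZl//=; first last.
- by rewrite lee_fin mulr_ge0// ?invr_ge0 ltW.
- by move=> s _; rewrite lee_fin mulr_ge0 ?expR_ge0 ?powR_ge0.
- exact: measurable_powR_expR.
(* The substitution t = c s is made in the Gamma integral on the right; s^(-b) = c^b (c s)^(-b) then
   matches the two sides. *)
rewrite (@ge0_integral_scale _ c (fun t => (t `^ (- b) * expR (- t))%:E))//; last 2 first.
- exact: measurable_Gamma_integrand.
- by move=> s _; rewrite lee_fin mulr_ge0 ?expR_ge0 ?powR_ge0.
transitivity ((b^-1 * c)%:E * \int[lebesgue_measure]_(s in `]0%R, +oo[)
  ((c `^ b)%:E * ((c * s) `^ (- b) * expR (- (c * s)))%:E))%E.
  congr (_ * _)%E; apply: eq_integral => s; rewrite inE/= in_itv/= andbT => s0.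
  rewrite -EFinM; congr (_%:E).
  rewrite powRM ?ltW// mulNr !mulrA -powRD ?subrr ?powRr0 ?mul1r//.
  by rewrite (gt_eqF c0) implybT.
rewrite ge0_integralZl//=; last 3 first.
- apply/measurable_EFinP/measurable_funTS.
  apply: measurable_funM.
    apply: (measurableT_comp (measurable_powR _)); exact: measurable_funM.
  apply: (measurableT_comp (@measurable_expR R)).
  by apply: measurableT_comp => //; exact: measurable_funM.
- by move=> s _; rewrite lee_fin mulr_ge0 ?expR_ge0 ?powR_ge0.
- by rewrite lee_fin powR_ge0.
by rewrite !muleA -!EFinM; congr (_%:E * _)%E; ring.
Qed.

(** * The value of Gamma at 1 - b and the constant c_beta *)

Lemma integral_powR_itv01_le (R : realType) (b : R) : 0 < b < 1 ->
  (\int[lebesgue_measure]_(x in `]0%R, 1%R]) (x `^ (- b))%:E <=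
   ((1 - b)^-1)%:E)%E.
Proof.
move=> /andP[b0 b1].
have b1' : 0 < 1 - b by rewrite subr_gt0.
(* The power is singular at 0, so the fundamental theorem is applied on these compact intervals,
   which increase to []0, 1]]; monotone convergence passes to the limit. *)
pose F (n : nat) : set R := `[n.+1%:R^-1, 1]%classic.
have UF : \bigcup_n F n = `]0, 1]%classic :> set R.
  apply/seteqP; split => [x [n _]|x]; rewrite /F/= !in_itv/= => /andP[x0 x1].
    by rewrite x1 andbT (lt_le_trans _ x0)// invr_gt0.
  have [n _ /(_ n (leqnn n))] := near_infty_natSinv_lt (PosNum x0).
  by move=> /ltW nx; exists n => //; rewrite /= in_itv/= nx x1.
have mf i : measurable_fun (F i) (fun x : R => (x `^ (- b))%:E).
  exact: measurable_EFin_powR.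
have cv : (\int[lebesgue_measure]_(x in F n) (x `^ (- b))%:E @[n --> \oo] -->
    \int[lebesgue_measure]_(x in `]0%R, 1%R]) (x `^ (- b))%:E)%E.
  rewrite -UF; apply: ge0_nondecreasing_set_cvg_integral => //.
  - move=> m n mn; apply/subsetPset => x; rewrite /F/= !in_itv/= => /andP[mx ->].
    by rewrite andbT (le_trans _ mx)// lef_pV2 ?posrE// ler_nat.
  - by move=> i; exact: measurable_itv.
  - by move=> i x _; rewrite lee_fin powR_ge0.
apply: (cvge_to_le cv).
apply: nearW => n.
(* For n = 0 the interval is the single point 1, while the fundamental theorem needs distinct
   endpoints. *)
have [->|n0] := eqVneq n 0%N.
  rewrite /F invr1 set_itv1 integral_set1 lee_fin invr_ge0 ltW//.
have n1 : n.+1%:R^-1 < 1 :> R.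
  by rewrite invf_lt1// ltr1n ltnS lt0n.
have np : 0 < n.+1%:R^-1 :> R by rewrite invr_gt0.
have dF (x : R) : 0 < x ->
    is_derive x 1 (fun y : R => (1 - b)^-1 * y `^ (1 - b)) (x `^ (- b)).
  move=> x0.
  have -> : x `^ (- b) = (1 - b)^-1 *: ((1 - b) * x `^ (1 - b - 1)).
    rewrite /GRing.scale/= mulrA mulVf ?gt_eqF// mul1r; congr (_ `^ _); ring.
  exact/is_deriveZ/is_derive1_powR.
rewrite (@continuous_FTC2 _ _ (fun y : R => (1 - b)^-1 * y `^ (1 - b)))//.
- rewrite powR1 mulr1 -EFinB lee_fin lerBlDr lerDl.
  by rewrite mulr_ge0 ?powR_ge0// invr_ge0 ltW.
- apply: continuous_in_subspaceT => x; rewrite inE/= in_itv/= => /andP[nx _].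
  by apply: continuous_powR; exact: lt_le_trans nx.
- split.
  + by move=> x; rewrite in_itv/= => /andP[nx _]; have [] := dF x (lt_trans np nx).
  + by apply: cvg_at_right_filter; apply: cvgMr; exact: continuous_powR.
  + by apply: cvg_at_left_filter; apply: cvgMr; exact: continuous_powR.
- move=> x; rewrite in_itv/= => /andP[nx _].
  by rewrite derive1E; have [_ ->] := dF x (lt_trans np nx).
Qed.

Lemma Gamma_integrand_ge0 (R : realType) (b t : R) :
  (0 <= (t `^ (- b) * expR (- t))%:E)%E.
Proof. by rewrite lee_fin mulr_ge0 ?powR_ge0 ?expR_ge0. Qed.

(** The integral is split at 1: the integrand is at most t^(-b) below 1, and at most the exponential
    density of rate 1 above. *)
Lemma integral_powR_expR_lty (R : realType) (b : R) : 0 < b < 1 ->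
  (\int[lebesgue_measure]_(t in `]0%R, +oo[) (t `^ (- b) * expR (- t))%:E
   < +oo)%E.
Proof.
move=> /[dup] b01 /andP[b0 b1].
rewrite (_ : `]0%R, +oo[%classic = `]0, 1]%classic `|` `]1, +oo[%classic); last first.
  by rewrite -itv_bndbnd_setU// bnd_simp.
rewrite ge0_integral_setU//=.
- apply: lte_add_pinfty.
    apply: (@le_lt_trans _ _ (1 - b)^-1%:E); last exact: ltry.
    refine (le_trans _ (integral_powR_itv01_le b01)).
    apply: ge0_le_integral => //=.
    + by move=> x _; exact: Gamma_integrand_ge0.
    + exact: measurable_Gamma_integrand.
    + exact: measurable_EFin_powR.
    + move=> x; rewrite in_itv/= => /andP[x0 _].
      by rewrite lee_fin ler_piMr ?powR_ge0// -expR0 ler_expR oppr_le0 ltW.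
  apply: le_lt_trans (ltry 1); rewrite -(@integral_exponential_pdf R 1)//.
  apply: (@le_trans _ _ (\int[lebesgue_measure]_(t in `]1%R, +oo[)
    (exponential_pdf 1 t)%:E)%E).
    apply: ge0_le_integral => //=.
    + by move=> x _; exact: Gamma_integrand_ge0.
    + exact: measurable_Gamma_integrand.
    + by apply/measurable_EFinP; apply: measurable_funTS;
        exact: measurable_exponential_pdf.
    + move=> x; rewrite in_itv/= andbT => x1.
      rewrite lee_fin exponential_pdfE ?(le_trans _ (ltW x1))// mul1r mulN1r.
      rewrite ler_piMl ?expR_ge0// powRN invf_le1 ?powR_gt0//.
        by rewrite -[leLHS](powRr0 x) ler_powR// ltW.
      exact: lt_trans x1.
  apply: ge0_subset_integral => //=.
  + by apply/measurable_EFinP; exact: measurable_exponential_pdf.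
  + by move=> x _; rewrite lee_fin exponential_pdf_ge0.
- exact: measurable_Gamma_integrand.
- by move=> x _; exact: Gamma_integrand_ge0.
- apply/disj_setPS => x [] /=; rewrite !in_itv/= andbT => /andP[_ x1] x1'.
  by have := lt_le_trans x1' x1; rewrite ltxx.
Qed.

(** [Gamma] is a real-valued integral, so finiteness is what identifies it with the extended-real
    one. *)
Lemma GammaE (R : realType) (b : R) : 0 < b < 1 ->
  (\int[lebesgue_measure]_(t in `]0%R, +oo[) (t `^ (- b) * expR (- t))%:E
   = (Gamma (1 - b))%:E)%E.
Proof.
move=> b01; rewrite /Gamma /Rintegral fineK.
  by apply: eq_integral => t _; do 3 f_equal; ring.
have -> : 1 - b - 1 = - b by ring.
rewrite ge0_fin_numE ?integral_powR_expR_lty//.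
by apply: integral_ge0 => t _; exact: Gamma_integrand_ge0.
Qed.

(** On []0, 1]] the integrand is at least e^(-1). Positivity permits cancelling the Gamma factor in
    the denominator of c_beta. *)
Lemma Gamma_onem_gt0 (R : realType) (b : R) : 0 < b < 1 -> 0 < Gamma (1 - b).
Proof.
move=> b01; rewrite -lte_fin -GammaE//.
apply: (@lt_le_trans _ _ (\int[lebesgue_measure]_(t in `]0%R, 1%R]) (expR (- 1))%:E)%E).
  rewrite integral_cst//= lebesgue_measure_itv/= lte_fin ltr01 sube0 mule1.
  by rewrite lte_fin expR_gt0.
apply: (@le_trans _ _ (\int[lebesgue_measure]_(t in `]0%R, 1%R])
    (t `^ (- b) * expR (- t))%:E)%E).
  apply: ge0_le_integral => //=.
  - exact: measurable_Gamma_integrand.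
  - move=> x; rewrite in_itv/= => /andP[x0 x1]; rewrite lee_fin.
    rewrite -[leLHS]mul1r ler_pM ?expR_ge0//; last by rewrite ler_expR lerN2.
    rewrite powRN invf_ge1 ?powR_gt0//; move: b01 => /andP[b0 _].
    have := @ge0_ler_powR _ b (ltW b0) x 1; rewrite powR1.
    by apply => //; rewrite nnegrE ltW.
apply: ge0_subset_integral => //=.
- exact: measurable_Gamma_integrand.
- by move=> x _; exact: Gamma_integrand_ge0.
- by move=> x /=; rewrite !in_itv/= => /andP[->].
Qed.

Lemma karlin_cst_ge0 (R : realType) (b : R) : 0 < b < 1 -> 0 <= karlin_cst b.
Proof.
move=> /[dup] b01 /andP[b0 _].
by rewrite divr_ge0 ?mulr_ge0 ?powR_ge0 ?ltW ?Gamma_onem_gt0.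
Qed.

(** This is what the normalisation c_beta is made for: the integral equals (1/2) (2 l)^b Gamma(1 -
    b) / b, by the preceding formula with c = 2 l. At l = 0 both sides vanish. *)
Lemma karlin_cst_integral (R : realType) (b l : R) : 0 < b < 1 -> 0 <= l ->
  ((karlin_cst b)%:E * \int[lebesgue_measure]_(r in `]0%R, +oo[)
     ((r `^ (- b - 1))%:E * ((1 - expR (- (2 * (r * l)))) / 2)%:E) =
   (l `^ b)%:E)%E.
Proof.
move=> /[dup] b01 /andP[b0 b1]; rewrite le_eqVlt => /predU1P[<-|l0].
  rewrite powR0 ?gt_eqF// integral0_eq ?mule0// => r _.
  by rewrite !mulr0 oppr0 expR0 subrr mul0r mule0.
transitivity ((karlin_cst b)%:E * \int[lebesgue_measure]_(r in `]0%R, +oo[)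
     ((2^-1)%:E * (r `^ (- b - 1) * (1 - expR (- (2 * l) * r)))%:E))%E.
  congr (_ * _)%E; apply: eq_integral => r _; rewrite -!EFinM; congr (_%:E).
  by rewrite [RHS]mulrC -mulrA; congr (_ * ((1 - expR _) * _)); ring.
rewrite ge0_integralZl//=; last 2 first.
- apply/measurable_EFinP; apply: measurable_funM.
    by apply: measurable_funTS; exact: measurable_powR.
  by apply: measurable_funB => //; exact: measurable_expRM.
- move=> r; rewrite in_itv/= andbT => r0; rewrite lee_fin mulr_ge0 ?powR_ge0//.
  rewrite subr_ge0 -expR0 ler_expR mulNr oppr_le0 !mulr_ge0// ltW//.
rewrite integral_powR_onem_expR ?mulr_gt0// GammaE// -!EFinM; congr (_%:E).
have -> : karlin_cst b = b * (2 / 2 `^ b) / Gamma (1 - b).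
  rewrite /karlin_cst powRB ?powRr1//.
  by rewrite pnatr_eq0 implybT.
rewrite powRM ?ltW//.
have G0 := Gamma_onem_gt0 b01.
have p2 : 0 < 2 `^ b :> R by exact: powR_gt0.
by field; rewrite !gt_eqF.
Qed.

(** * Parity of Poisson counts *)

Lemma cvg_series_exp_coeff (R : realType) (x : R) :
  series (exp_coeff x) @ \oo --> expR x.
Proof. exact: is_cvg_series_exp_coeff. Qed.

(** Subtracting the exponential series at - x from the one at x cancels the even terms and doubles
    the odd ones; the limit is sinh x. *)
Lemma cvg_series_exp_coeff_odd (R : realType) (x : R) :
  series (fun k => if k \in [set k | odd k] then exp_coeff x k else 0) @ \oo -->
    (expR x - expR (- x)) / 2.
Proof.
rewrite (_ : series _ = fun n =>
    (series (exp_coeff x) n - series (exp_coeff (- x)) n) / 2); last first.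
  apply/funext => n; rewrite /series/= -sumrB big_distrl/=; apply: eq_bigr => k _.
  have -> : (k \in [set k | odd k]) = odd k by rewrite mem_setE.
  rewrite /exp_coeff/= exprNn -signr_odd -mulrA; move: (x ^+ k / k`!%:R) => a.
  by case: (odd k); rewrite ?expr1 ?expr0; field.
by apply: cvgMl; apply: cvgB; exact: cvg_series_exp_coeff.
Qed.

Section poisson.
Context (R : realType) (d : measure_display) (E : measurableType d).
Implicit Types (D : set E) (Q : probability (pmspace E R) R).

Lemma measurable_eval D : measurable D ->
  measurable_fun setT (fun m : pmspace E R => (m : point_measure E R) D).
Proof.
move=> mD _ Y mY; rewrite setTI; apply: sub_gen_smallest.
by exists D => //; exists Y => //; rewrite setTI.
Qed.

Lemma measurable_eval_eq D (x : \bar R) : measurable D ->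
  measurable ([set m : point_measure E R | m D = x] : set (pmspace E R)).
Proof.
move=> mD.
have := (measurable_eval mD measurableT (emeasurable_set1 x)).
by rewrite setTI.
Qed.

(** Since a count may be [+oo], [count_in setT D] is the event that D contains finitely many points,
    not the whole space. *)
Definition count_in (N : set nat) D : set (pmspace E R) :=
  \bigcup_(k in N) [set m : point_measure E R | m D = k%:R%:E].

Lemma odd_atE D : odd_at D = count_in [set k | odd k] D.
Proof.
by apply/seteqP; split => m /= [k ok mk]; exists k.
Qed.

Lemma measurable_count_in N D : measurable D -> measurable (count_in N D).
Proof. by move=> mD; apply: bigcup_measurable => k _; exact: measurable_eval_eq. Qed.

Lemma measurable_odd_at D : measurable D -> measurable (@odd_at _ E R D).
Proof. by move=> mD; rewrite odd_atE; exact: measurable_count_in. Qed.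

(** The events of having exactly k points are disjoint, and their Poisson weights share the factor
    e^(- nu D); only a subseries of the exponential series remains to be summed. *)
Lemma poisson_count_in (nu : set E -> \bar R) Q (N : set nat) D (l : R) :
  poisson_process_law nu Q -> measurable D -> (nu D < +oo)%E ->
  series (fun k => if k \in N then exp_coeff (fine (nu D)) k else 0) @ \oo --> l ->
  Q (count_in N D) = (l * expR (- fine (nu D)))%:E.
Proof.
move=> pQ mD nuoo cl.
rewrite /count_in measure_bigcup; last 2 first.
- by move=> k _; exact: measurable_eval_eq.
- by move=> i j _ _ [m [/= -> /eqP]]; rewrite eqe eqr_nat => /eqP->.
apply: cvg_lim => //.
rewrite (_ : (fun n => _) = EFin \o
    (fun n => series (fun k => if k \in N then exp_coeff (fine (nu D)) k else 0) n
              * expR (- fine (nu D)))); last first.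
  apply/funext => n /=; rewrite /series/= big_distrl/= -sumEFin [LHS]big_mkcond/=.
  apply: eq_bigr => k _; case: ifPn => kN; last by rewrite mul0r.
  by rewrite (poisson_law_fin pQ mD nuoo)// /exp_coeff.
apply: cvg_EFin; first by apply: nearW.
exact: cvgMl.
Qed.

Lemma poisson_finite_ae (nu : set E -> \bar R) Q D :
  poisson_process_law nu Q -> measurable D -> (nu D < +oo)%E ->
  Q (count_in setT D) = 1%E.
Proof.
move=> pQ mD nuoo.
rewrite (@poisson_count_in _ _ _ _ (expR (fine (nu D))) pQ)//.
  by rewrite -expRD subrr expR0.
rewrite (_ : series _ = series (exp_coeff (fine (nu D)))).
  exact: cvg_series_exp_coeff.
by congr series; apply/funext => k; rewrite in_setT.
Qed.

(** With v the mean, sinh(v) e^(-v) = (1 - e^(-2v)) / 2. *)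
Lemma poisson_odd_at (nu : set E -> \bar R) Q D :
  poisson_process_law nu Q -> measurable D -> (nu D < +oo)%E ->
  Q (odd_at D) = ((1 - expR (- (2 * fine (nu D)))) / 2)%:E.
Proof.
move=> pQ mD nuoo.
rewrite odd_atE (poisson_count_in pQ mD nuoo (@cvg_series_exp_coeff_odd R _)).
congr (_%:E); rewrite mulrAC mulrBl -!expRD subrr expR0.
by congr ((1 - expR _) / 2); ring.
Qed.

(** If A minus B, the intersection and B minus A contain i, j and k points, then A, B and A Delta B
    contain i + j, k + j and i + k, and 2 j drops out modulo 2. Finiteness matters: infinitely many
    points in the intersection would make neither A nor B odd, whatever i + k is. *)
Lemma odd_at_symdiff (m : pmspace E R) (A B : set E) :
  measurable A -> measurable B ->
  count_in setT (A `\` B) m -> count_in setT (A `&` B) m ->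
  count_in setT (B `\` A) m ->
  odd_at (A `+` B) m <-> (odd_at A `+` odd_at B) m.
Proof.
move=> mA mB [i _ /= iE] [j _ /= jE] [k _ /= kE].
have mAB : measurable (A `\` B) by exact: measurableD.
have mBA : measurable (B `\` A) by exact: measurableD.
have mI : measurable (A `&` B) by exact: measurableI.
have mU X Y : measurable X -> measurable Y -> X `&` Y = set0 ->
    (m : point_measure E R) (X `|` Y) =
    ((m : point_measure E R) X + (m : point_measure E R) Y)%E.
  by move=> mX mY XY; exact: measureU.
have AE : (m : point_measure E R) A = (i + j)%:R%:E.
  rewrite -[in LHS](setUIDK A B) mU//.
    by rewrite iE jE natrD EFinD addeC.
  by apply/seteqP; split => z //= [[_ zB] [_ /(_ zB)]].
have BE : (m : point_measure E R) B = (k + j)%:R%:E.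
  rewrite -[in LHS](setUIDK B A) mU//; first by rewrite setIC kE jE natrD EFinD addeC.
    by rewrite setIC.
  by apply/seteqP; split => z //= [[_ zB] [_ /(_ zB)]].
have ABE : (m : point_measure E R) (A `+` B) = (i + k)%:R%:E.
  rewrite /setY mU//; first by rewrite iE kE natrD EFinD.
  by apply/seteqP; split => z //= [[_ zB] [/zB]].
have oE D (n : nat) : (m : point_measure E R) D = n%:R%:E -> odd_at D m <-> odd n.
  move=> mn; split => [[k' ok' /=]|on]; last by exists n.
  by rewrite mn => /eqP; rewrite eqe eqr_nat => /eqP ->.
rewrite (oE _ _ ABE) /setY/= (oE _ _ AE) (oE _ _ BE) !oddD.
have T : true by [].
have F : ~ false by [].
by case: (odd i); case: (odd j); case: (odd k) => /=; tauto.
Qed.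

End poisson.

(** * The Karlin measure of parity events *)

Lemma eq_measure_negligible (R : realType) (d : measure_display)
    (T : measurableType d) (m : {measure set T -> \bar R}) (X Y N : set T) :
  measurable X -> measurable Y -> m.-negligible N -> X `+` Y `<=` N ->
  m X = m Y.
Proof.
move=> mX mY nN XYN.
have m0 U V : measurable U -> measurable V -> U `\` V `<=` N -> m (U `\` V) = 0.
  move=> mU mV UVN; apply: measure_negligible; first exact: measurableD.
  exact: negligibleS nN.
have mE U V : measurable U -> measurable V -> U `\` V `<=` N -> m U = m (U `&` V).
  move=> mU mV UVN; rewrite -[RHS]add0e -(m0 U V)//; exact: measureDI.
rewrite (mE X Y)// 1?(mE Y X)// 1?setIC// => z zXY; apply: XYN.
  by right.
by left.
Qed.

(** The probability that a Poisson variable of mean l is odd. *)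
Definition odd_prob (R : realType) (l : R) : R := (1 - expR (- (2 * l))) / 2.

Section karlin_odd.
Context (R : realType) (d : measure_display) (E : measurableType d).
Variables (mu : {measure set E -> \bar R}) (P' : R -> probability (pmspace E R) R).
Hypothesis hP' : forall r : R, 0 < r ->
  poisson_process_law (fun B => (r%:E * mu B)%E) (P' r).

Lemma scale_lty (r : R) (S : set E) : 0 < r -> (mu S < +oo)%E ->
  (r%:E * mu S < +oo)%E.
Proof. by move=> r0 Soo; rewrite lte_mul_pinfty// lee_fin ltW. Qed.

Lemma poisson_scale_odd_at (r : R) (S : set E) : 0 < r -> measurable S ->
  (mu S < +oo)%E -> P' r (odd_at S) = (odd_prob (r * fine (mu S)))%:E.
Proof.
move=> r0 mS Soo.
rewrite (poisson_odd_at (hP' r0) mS (scale_lty r0 Soo)).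
by rewrite fineM// ge0_fin_numE.
Qed.

(** The two events agree wherever A minus B, the intersection and B minus A have finite counts,
    which is almost sure because their means are finite. *)
Lemma poisson_odd_symdiff (r : R) (A B : set E) : 0 < r ->
  measurable A -> measurable B -> (mu A < +oo)%E -> (mu B < +oo)%E ->
  P' r (odd_at A `+` odd_at B) = P' r (odd_at (A `+` B)).
Proof.
move=> r0 mA mB Aoo Boo.
have nF S T : measurable S -> measurable T -> (mu T < +oo)%E -> S `<=` T ->
    (P' r).-negligible (~` @count_in R d E setT S).
  move=> mS mT Too ST; apply/negligibleP.
    by apply: measurableC; exact: measurable_count_in.
  refine (etrans (probability_setC _ (measurable_count_in _ mS)) _).
  rewrite (poisson_finite_ae (hP' r0) mS) ?subee//.
  by rewrite scale_lty// (le_lt_trans _ Too)// le_measure ?inE.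
apply: (@eq_measure_negligible _ _ _ _ _ _
  (~` @count_in R d E setT (A `\` B) `|` (~` @count_in R d E setT (A `&` B) `|`
   ~` @count_in R d E setT (B `\` A)))).
- by apply: measurableU; apply: measurableD; exact: measurable_odd_at.
- by apply: measurable_odd_at; apply: measurableU; exact: measurableD.
- apply: negligibleU; last apply: negligibleU.
  + exact: (nF _ A (measurableD mA mB)).
  + exact: (nF _ A (measurableI _ _ mA mB)).
  + exact: (nF _ B (measurableD mB mA)).
- move=> m; apply: contraPP; rewrite -!setCI => /contrapT[Fi [Fj Fk]].
  have := odd_at_symdiff mA mB Fi Fj Fk.
  rewrite /setY/=; tauto.
Qed.

(* [P'] is not assumed measurable in [r]; the additivity of [karlin_measure]
   rests on this probability being an explicit function of [r]. *)
Lemma poisson_odd_diff (r : R) (A B : set E) : 0 < r ->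
  measurable A -> measurable B -> (mu A < +oo)%E -> (mu B < +oo)%E ->
  P' r (odd_at A `\` odd_at B) =
  ((odd_prob (r * fine (mu A)) + odd_prob (r * fine (mu (A `+` B))) -
    odd_prob (r * fine (mu B))) / 2)%:E.
Proof.
move=> r0 mA mB Aoo Boo.
have mAB : measurable (A `+` B) by apply: measurableU; exact: measurableD.
have ABoo : (mu (A `+` B) < +oo)%E.
  rewrite (@le_lt_trans _ _ (mu A + mu B)%E) ?lte_add_pinfty//.
  apply: (@le_trans _ _ (mu (A `|` B))); last exact: measureU2.
  apply: le_measure; rewrite ?inE//; first exact: measurableU.
  by move=> z [[? _]|[? _]]; [left|right].
have moA := @measurable_odd_at R _ _ _ mA.
have moB := @measurable_odd_at R _ _ _ mB.
have pA := poisson_scale_odd_at r0 mA Aoo.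
have pB := poisson_scale_odd_at r0 mB Boo.
have pAB := poisson_scale_odd_at r0 mAB ABoo.
have DU : P' r (odd_at A `+` odd_at B) =
    (P' r (odd_at A `\` odd_at B) + P' r (odd_at B `\` odd_at A))%E.
  apply: measureU; [exact: measurableD|exact: measurableD|].
  by apply/seteqP; split => z //= [[_ zB] [/zB]].
rewrite -poisson_odd_symdiff// DU in pAB.
have DI X Y : measurable X -> measurable Y ->
    P' r X = (P' r (X `\` Y) + P' r (X `&` Y))%E.
  by move=> mX mY; exact: measureDI.
rewrite (DI _ _ moA moB) in pA.
rewrite (DI _ _ moB moA) setIC in pB.
have fin X : measurable X -> P' r X = (fine (P' r X))%:E.
  by move=> mX; rewrite fineK// fin_num_measure.
(* With a and b the probabilities of the two differences and c that of the intersection, the known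
   quantities are a + c, b + c and a + b; hence a = ((a + c) + (a + b) - (b + c)) / 2. *)
move: pA pB pAB.
rewrite (fin _ (measurableD moA moB)) (fin _ (measurableD moB moA)).
rewrite (fin _ (measurableI _ _ moA moB)) -!EFinD => -[<-] [<-] [<-].
by congr (_%:E); field.
Qed.

Lemma odd_prob_ge0 (l : R) : 0 <= l -> 0 <= odd_prob l.
Proof.
move=> l0; rewrite divr_ge0// subr_ge0 -expR0 ler_expR oppr_le0 mulr_ge0//.
Qed.

Lemma measurable_odd_prob (l : R) (D : set R) :
  measurable_fun D (fun r : R => odd_prob (r * l)).
Proof.
apply: measurable_funTS; apply: measurable_funM => //.
apply: measurable_funB => //.
apply: (measurableT_comp (@measurable_expR R)).
apply: measurableT_comp => //.
by apply: measurable_funM => //; exact: measurable_funM.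
Qed.

Lemma karlin_odd_at (b : R) (S : set E) : 0 < b < 1 -> measurable S ->
  (mu S < +oo)%E -> karlin_measure b P' (odd_at S) = (fine (mu S) `^ b)%:E.
Proof.
move=> b01 mS Soo; rewrite -(karlin_cst_integral b01 (fine_ge0 (measure_ge0 mu S))).
congr (_ * _)%E; apply: eq_integral => r; rewrite inE/= in_itv/= andbT => r0.
by rewrite poisson_scale_odd_at.
Qed.

Lemma karlin_measure_ge0 (b : R) (X : set (pmspace E R)) : 0 < b < 1 ->
  (0 <= karlin_measure b P' X)%E.
Proof.
move=> b01; rewrite mule_ge0 ?lee_fin ?karlin_cst_ge0//.
by apply: integral_ge0 => r _; rewrite mule_ge0// lee_fin powR_ge0.
Qed.

(** For each r > 0 the two differences partition the symmetric difference of the odd events, which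
    has the [P' r]-probability of [odd_at] at A Delta B. The identity is then integrated over r. *)
Lemma karlin_odd_diffD (b : R) (A B : set E) : 0 < b < 1 ->
  measurable A -> measurable B -> (mu A < +oo)%E -> (mu B < +oo)%E ->
  (mu (A `+` B) < +oo)%E ->
  (karlin_measure b P' (odd_at A `\` odd_at B) +
   karlin_measure b P' (odd_at B `\` odd_at A) =
   (fine (mu (A `+` B)) `^ b)%:E)%E.
Proof.
move=> b01 mA mB Aoo Boo ABoo.
have mAB : measurable (A `+` B) by apply: measurableU; exact: measurableD.
have moA := @measurable_odd_at R _ _ _ mA.
have moB := @measurable_odd_at R _ _ _ mB.
rewrite -karlin_odd_at// /karlin_measure -ge0_muleDr; last 2 first.
- by apply: integral_ge0 => r _; rewrite mule_ge0// lee_fin powR_ge0.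
- by apply: integral_ge0 => r _; rewrite mule_ge0// lee_fin powR_ge0.
have mdiff (S T : set E) : measurable S -> measurable T -> (mu S < +oo)%E ->
    (mu T < +oo)%E -> measurable_fun (`]0, +oo[%classic : set R)
    (fun r => (r `^ (- b - 1))%:E * P' r (odd_at S `\` odd_at T))%E.
  move=> mS mT Soo Too.
  (* On r > 0 the integrand coincides with this explicit function, whose measurability is
     elementary. *)
  apply: (@eq_measurable_fun _ _ _ _ _ (fun r => (r `^ (- b - 1) *
    ((odd_prob (r * fine (mu S)) + odd_prob (r * fine (mu (S `+` T))) -
    odd_prob (r * fine (mu T))) / 2))%:E)).
    move=> r; rewrite inE/= in_itv/= andbT => r0.
    by rewrite poisson_odd_diff.
  apply/measurable_EFinP; apply: measurable_funM.
    by apply: measurable_funTS; exact: measurable_powR.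
  apply: measurable_funM => //.
  apply: measurable_funB; last exact: measurable_odd_prob.
  by apply: measurable_funD; exact: measurable_odd_prob.
rewrite -ge0_integralD//=; last 4 first.
- by move=> r _; rewrite mule_ge0// lee_fin powR_ge0.
- exact: mdiff.
- by move=> r _; rewrite mule_ge0// lee_fin powR_ge0.
- exact: mdiff.
congr (_ * _)%E; apply: eq_integral => r; rewrite inE/= in_itv/= andbT => r0.
rewrite -ge0_muleDr// -poisson_odd_symdiff// measureU//.
- exact: measurableD.
- exact: measurableD.
- by apply/seteqP; split => z //= [[_ zB] [/zB]].
Qed.

End karlin_odd.

(** * Product rule for expectations of two independent variables *)

Section independent_pair.
Context (R : realType) (dO : measure_display) (Omega : measurableType dO).
Variable P : probability Omega R.

Lemma bounded_integrable d (T : measurableType d) (m : probability T R)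
    (f : T -> R) :
  measurable_fun setT f -> (forall x, `|f x| <= 1) ->
  m.-integrable setT (EFin \o f).
Proof.
move=> mf f1; apply: measurable_bounded_integrable => //.
  by rewrite -ge0_fin_numE//; exact: fin_num_measure.
by exists 1; split => // M M1 x _; exact: le_trans (f1 x) (ltW M1).
Qed.

Lemma Rintegral_distribution (X : {RV P >-> R}) (f : R -> R) :
  measurable_fun setT f -> (forall x, `|f x| <= 1) ->
  \int[distribution P X]_x f x = \int[P]_w f (X w).
Proof.
move=> mf f1; rewrite /Rintegral integral_distribution//.
  exact/measurable_EFinP.
apply: bounded_integrable => [|w]; last exact: f1.
exact: measurableT_comp.
Qed.

(** Independence says that the joint law agrees with the product of the marginals on rectangles, so
    the two are equal; Fubini then separates the bounded factors. *)
Lemma Rintegral_independentM (X : 'I_2 -> {RV P >-> R}) (f g : R -> R) :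
  independent_family P (fun i => X i : Omega -> R) ->
  measurable_fun setT f -> measurable_fun setT g ->
  (forall x, `|f x| <= 1) -> (forall x, `|g x| <= 1) ->
  \int[P]_w (f (X ord0 w) * g (X ord_max w)) =
  (\int[P]_w f (X ord0 w)) * (\int[P]_w g (X ord_max w)).
Proof.
move=> indX mf mg f1 g1.
rewrite -!Rintegral_distribution//.
pose m1 : probability R R := distribution P (X ord0).
pose m2 : probability R R := distribution P (X ord_max).
pose Z w := (X ord0 w, X ord_max w).
have mZ : measurable_fun setT Z by exact: measurable_fun_pair.
unshelve epose (m' := pushforward P Z : {measure set (R * R) -> \bar R}).
  exact: mZ.
have m'E A B : measurable A -> measurable B -> m' (A `*` B) = (m1 A * m2 B)%E.
  move=> mA mB.
  pose C (i : 'I_2) := if i == ord0 then A else B.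
  have mC i : measurable (C i) by rewrite /C; case: ifP.
  have := indX C mC.
  rewrite big_ord_recl big_ord1 /C/= => PE.
  have -> : m' (A `*` B) = P (\bigcap_(i in [set: 'I_2]) (X i @^-1` C i)).
    congr (P _); apply/seteqP; split => w /=.
      move=> [XA XB] [[|[|//]] i2] _ /=; rewrite /C/=.
        by rewrite (_ : Ordinal i2 = ord0)//; exact: val_inj.
      by rewrite (_ : Ordinal i2 = ord_max)//; exact: val_inj.
    by move=> h; split; [have := h ord0 I|have := h ord_max I].
  have mX i (D : set R) : measurable D -> measurable (X i @^-1` D).
    by move=> mD; rewrite -[_ @^-1` _]setTI; exact: measurable_funP.
  have fX i (D : set R) : measurable D -> P (X i @^-1` D) \is a fin_num.
    by move=> mD; apply: fin_num_measure; exact: mX.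
  rewrite PE EFinM !fineK; [|exact: fX|exact: fX].
  change (P (X ord0 @^-1` A) * P (X (lift ord0 ord0) @^-1` B) =
    P (X ord0 @^-1` A) * P (X ord_max @^-1` B))%E.
  by congr (_ * P (X _ @^-1` B))%E; exact: val_inj.
pose h (z : R * R) := f z.1 * g z.2.
have mh : measurable_fun setT (EFin \o h).
  apply/measurable_EFinP; apply: measurable_funM; exact: measurableT_comp.
have h1 z : `|h z| <= 1 by rewrite /h normrM mulr_ile1.
have int_f : m1.-integrable setT (EFin \o f) by exact: bounded_integrable.
have int_g : m2.-integrable setT (EFin \o g) by exact: bounded_integrable.
rewrite {1}/Rintegral.
have -> : (\int[P]_w (f (X ord0 w) * g (X ord_max w))%:E =
    \int[m']_z (h z)%:E)%E.
  rewrite /m' integral_pushforward//.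
  apply: bounded_integrable => [|w]; last exact: h1.
  by apply/measurable_EFinP; exact: (measurableT_comp mh mZ).
have -> : (\int[m']_z (h z)%:E = \int[m1 \x m2]_z (h z)%:E)%E.
  by apply: eq_measure_integral => D mD _; rewrite -(product_measure_unique m'E).
rewrite -integral12_prod_meas1/=; last first.
  apply: (@bounded_integrable _ _ (m1 \x m2)%E) => //.
  exact/measurable_EFinP.
have inner x : fubini_F m2 (EFin \o h) x =
    ((\int[m2]_y g y)%:E * (f x)%:E)%E.
  rewrite /fubini_F /h/= /Rintegral fineK ?integrable_fin_num//.
  transitivity (\int[m2]_y ((f x)%:E * (g y)%:E))%E; first exact: eq_integral.
  by rewrite integralZl// muleC.
under eq_integral do rewrite inner.
by rewrite integralZl//= fineM ?integrable_fin_num// mulrC.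
Qed.

End independent_pair.

(** * Finite additivity of the random measure *)

Section random_measure.
Context (R : realType) (d : measure_display) (T : measurableType d).
Variables (alpha : R) (kappa : set T -> \bar R).
Context (dO : measure_display) (Omega : measurableType dO).
Variables (P : probability Omega R) (M : set T -> {RV P >-> R}).
Hypothesis hM : SaS_random_measure alpha kappa M.
Hypothesis kappa0 : kappa set0 = 0%E.

(** Countable additivity for a sequence of empty sets makes n v converge, where v is the value at
    the empty set. The increments of this sequence tend to 0 but are constantly v. *)
Lemma SaS_rm_set0 : {ae P, forall w, M set0 w = 0}.
Proof.
have t0 : trivIset [set: nat] (fun=> set0 : set T).
  by apply/trivIsetP => i j _ _ _; rewrite setI0.
have k0 : (kappa (\bigcup_(i in [set: nat]) set0) < +oo)%E.
  by rewrite bigcup0// kappa0.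
have := SaS_rm_additive hM (fun=> measurable0) t0 k0.
apply: filterS => w.
under eq_fun do rewrite sumr_const card_ord.
rewrite bigcup0// => cvM.
suff : M set0 w - M set0 w = M set0 w by rewrite subrr.
have c1 : (M set0 w *+ n.+1 - M set0 w *+ n) @[n --> \oo] -->
    M set0 w - M set0 w.
  apply: cvgB => //; have := cvM.
  by rewrite -(cvg_shiftS (fun n => M set0 w *+ n)).
have c2 : (M set0 w *+ n.+1 - M set0 w *+ n) @[n --> \oo] --> M set0 w.
  under eq_fun do rewrite mulrSr addrAC subrr add0r.
  exact: cvg_cst.
exact: (cvg_unique _ c1 c2).
Qed.

Lemma SaS_rm_setU (B C : set T) : measurable B -> measurable C ->
  B `&` C = set0 -> (kappa (B `|` C) < +oo)%E ->
  {ae P, forall w, M (B `|` C) w = M B w + M C w}.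
Proof.
move=> mB mC BC koo.
(* B and C are padded with empty sets to a sequence; from index 2 on the partial sums are almost
   surely constant. *)
have mb i : measurable (bigcup2 B C i) by case: i => [|[|i]] /=.
rewrite trivIset_bigcup2 in BC.
rewrite -bigcup2E in koo.
have := SaS_rm_additive hM mb BC koo.
apply: filterS2 SaS_rm_set0 => w M0 cvM.
rewrite bigcup2E in cvM.
have cS : (\sum_(i < n) M (bigcup2 B C i) w) @[n --> \oo] --> M B w + M C w;
  last exact: (cvg_unique _ cvM cS).
rewrite -(cvg_shiftn 2) /=.
under eq_fun => n.
  rewrite addn2 !big_ord_recl/= big1 ?addr0; last by move=> i _; exact: M0.
  over.
exact: cvg_cst.
Qed.

End random_measure.

(** * Stable laws through characteristic functions *)

Lemma measurable_cosM (R : realType) (t : R) :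
  measurable_fun setT (fun x : R => cos (t * x)).
Proof.
apply: (@measurableT_comp _ _ _ _ _ _ cos) => //.
  exact: (continuous_measurable_fun (@continuous_cos R)).
Qed.

Lemma measurable_sinM (R : realType) (t : R) :
  measurable_fun setT (fun x : R => sin (t * x)).
Proof.
apply: (@measurableT_comp _ _ _ _ _ _ sin) => //.
  exact: (continuous_measurable_fun (@continuous_sin R)).
Qed.

Lemma cosM_le1 (R : realType) (t x : R) : `|cos (t * x)| <= 1.
Proof. by rewrite ler_norml cos_geN1 cos_le1. Qed.

Lemma sinM_le1 (R : realType) (t x : R) : `|sin (t * x)| <= 1.
Proof. by rewrite ler_norml sin_geN1 sin_le1. Qed.

Section difference.
Context (R : realType) (dO : measure_display) (Omega : measurableType dO).
Variable P : probability Omega R.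

(** The target characteristic function is real, so the complex equation splits into a cosine and a
    vanishing sine expectation, both moved to [Omega] by change of variables. *)
Lemma SaS_lawP (alpha sigma : R) (X : {RV P >-> R}) :
  SaS_law alpha sigma (distribution P X) <->
  forall t, \int[P]_w cos (t * X w) = expR (- (sigma `^ alpha * `|t| `^ alpha)) /\
            \int[P]_w sin (t * X w) = 0.
Proof.
split=> h t.
  have := h t; rewrite /characteristic_function.
  rewrite Rintegral_distribution ?Rintegral_distribution//.
  - by case.
  - exact: measurable_sinM.
  - by move=> x; exact: sinM_le1.
  - exact: measurable_cosM.
  - by move=> x; exact: cosM_le1.
have [hc hs] := h t; rewrite /characteristic_function.
rewrite (@Rintegral_distribution _ _ _ _ _ (fun x => cos (t * x))).
- rewrite (@Rintegral_distribution _ _ _ _ _ (fun x => sin (t * x))).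
  + by rewrite hc hs.
  + exact: measurable_sinM.
  + by move=> x; exact: sinM_le1.
- exact: measurable_cosM.
- by move=> x; exact: cosM_le1.
Qed.

Lemma ae_eq_Rintegral (f g : Omega -> R) :
  measurable_fun setT f -> measurable_fun setT g ->
  {ae P, forall w, f w = g w} -> \int[P]_w f w = \int[P]_w g w.
Proof.
move=> mf mg fg; rewrite /Rintegral; congr fine; apply: ae_eq_integral => //.
- exact/measurable_EFinP.
- exact/measurable_EFinP.
- by apply: filterS fg => w -> _.
Qed.

Lemma SaS_law_ae (alpha sigma : R) (X Y : {RV P >-> R}) :
  {ae P, forall w, X w = Y w} ->
  SaS_law alpha sigma (distribution P X) -> SaS_law alpha sigma (distribution P Y).
Proof.
move=> XY /SaS_lawP hX; apply/SaS_lawP => t; have [<- <-] := hX t.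
split; apply: ae_eq_Rintegral.
- exact: (measurableT_comp (measurable_cosM t)).
- exact: (measurableT_comp (measurable_cosM t)).
- by apply: filterS XY => w ->.
- exact: (measurableT_comp (measurable_sinM t)).
- exact: (measurableT_comp (measurable_sinM t)).
- by apply: filterS XY => w ->.
Qed.

Lemma SaS_law_scale (alpha sigma k : R) (X : {RV P >-> R}) : 0 < k ->
  0 <= sigma ->
  SaS_law alpha sigma (distribution P X) ->
  SaS_law alpha (sigma * k) (distribution P (k \o* X : {RV P >-> R})).
Proof.
move=> k0 s0 /SaS_lawP hX; apply/SaS_lawP => t.
have [cE sE] := hX (t * k); split.
  under eq_Rintegral do rewrite /= mulrCA mulrC.
  rewrite cE normrM (gtr0_norm k0) !powRM// ?(ltW k0)//.
  by congr (expR (- _)); ring.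
by under eq_Rintegral do rewrite /= mulrCA mulrC.
Qed.

(** In the expansions of cos(u - v) and sin(u - v), independence factors each expectation and every
    term containing a sine vanishes. The product of the cosine expectations remains, so the scales
    add in their powers of order [alpha]. *)
Lemma SaS_law_sub (alpha s0 s1 s : R) (X : 'I_2 -> {RV P >-> R}) :
  independent_family P (fun i => X i : Omega -> R) ->
  SaS_law alpha s0 (distribution P (X ord0)) ->
  SaS_law alpha s1 (distribution P (X ord_max)) ->
  s `^ alpha = s0 `^ alpha + s1 `^ alpha ->
  SaS_law alpha s (distribution P (X ord0 \- X ord_max : {RV P >-> R})).
Proof.
move=> iX /SaS_lawP h0 /SaS_lawP h1 sE; apply/SaS_lawP => t.
have [c0 z0] := h0 t; have [c1 z1] := h1 t.
have indep f g := @Rintegral_independentM _ _ _ P X f g iX.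
have cm := @measurable_cosM R t; have sm := @measurable_sinM R t.
have cb := @cosM_le1 R t; have sb := @sinM_le1 R t.
have int (f g : R -> R) : measurable_fun setT f -> measurable_fun setT g ->
    (forall x, `|f x| <= 1) -> (forall x, `|g x| <= 1) ->
    P.-integrable setT (EFin \o (fun w => f (X ord0 w) * g (X ord_max w))).
  move=> mf mg f1 g1; apply: bounded_integrable.
    by apply: measurable_funM; exact: measurableT_comp.
  by move=> w; rewrite normrM mulr_ile1.
split.
  under eq_Rintegral do rewrite /= mulrBr cosB.
  rewrite RintegralD//;
    [|exact: (int _ _ cm cm cb cb)|exact: (int _ _ sm sm sb sb)].
  rewrite (indep (fun x => cos (t * x)) (fun x => cos (t * x)))//.
  rewrite (indep (fun x => sin (t * x)) (fun x => sin (t * x)))//.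
  rewrite c0 c1 z0 z1 mulr0 addr0 -expRD sE.
  by congr expR; ring.
under eq_Rintegral do rewrite /= mulrBr sinB.
rewrite RintegralB//;
  [|exact: (int _ _ sm cm sb cb)|exact: (int _ _ cm sm cb sb)].
rewrite (indep (fun x => sin (t * x)) (fun x => cos (t * x)))//.
rewrite (indep (fun x => cos (t * x)) (fun x => sin (t * x)))//.
by rewrite z0 z1 mul0r mulr0 subrr.
Qed.

End difference.

(** * The law of the normalised increment *)

Unset Implicit Arguments.

Theorem proposition3p5 (R : realType) (alpha beta : R)
  (halpha : 0 < alpha <= 2) (hbeta : 0 < beta < 1)
  (M : metricType R) (o : M)
  (G : groupType) (actM : G -> M -> M) (hactM : is_left_action actM)
  (d : measure_display) (E : measurableType d)
  (mu : {sigma_finite_measure set E -> \bar R})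
  (A : M -> set E) (mA : forall x, measurable (A x))
  (hdist : forall x y, (mdist x y)%:E = mu (A x `+` A y))
  (actE : G -> E -> E) (hactE : is_left_action actE)
  (mactE : forall g B, measurable B -> measurable (actE g @` B))
  (hactA : forall g x y,
     A (actM g x) `+` A (actM g y) = actE g @` (A x `+` A y) /\
     actE g @` (A x `+` A y) = (actE g @` A x) `+` (actE g @` A y))
  (hinv : forall g B, measurable B -> mu (actE g @` B) = mu B)
  (hAo : A o = set0)
  (P' : R -> probability (pmspace E R) R)
  (hP' : forall r, 0 < r ->
     poisson_process_law (fun B => (r%:E * mu B)%E) (P' r))
  (dO : measure_display) (Omega : measurableType dO) (P : probability Omega R)
  (Mab : set (pmspace E R) -> {RV P >-> R})
  (hMab : SaS_random_measure alpha (karlin_measure beta P') Mab) :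
  let eta (x : M) : {RV P >-> R} := karlin_process Mab (A x) in
  forall x y : M, x <> y ->
    SaS_law alpha 1
      (distribution P
         ((mdist x y `^ (beta / alpha))^-1 \o* (eta x \- eta y) : {RV P >-> R})).
Proof.
move=> eta x y xy.
have [alpha0 _] := andP halpha.
(* As A o is empty, the measure of A z is the distance from z to o. *)
have muoo z : (mu (A z) < +oo)%E.
  have -> : A z = A z `+` A o by rewrite hAo setY0.
  by rewrite -hdist ltry.
pose D := A x `+` A y.
have Doo : (mu D < +oo)%E by rewrite -hdist ltry.
have fD : fine (mu D) = mdist x y by rewrite -hdist.
have d0 : 0 < mdist x y.
  by rewrite lt_neqAle mdist_ge0 andbT eq_sym; apply/eqP => /mdist_positivity.
pose Ox : set (pmspace E R) := odd_at (A x).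
pose Oy : set (pmspace E R) := odd_at (A y).
have mOx : measurable Ox by exact: measurable_odd_at.
have mOy : measurable Oy by exact: measurable_odd_at.
pose kappa := karlin_measure beta P'.
(* This sum fixes the final scale; being finite, it also bounds each term, so that the random
   measure has a specified law on both differences. *)
have kD : (kappa (Ox `\` Oy) + kappa (Oy `\` Ox) = (mdist x y `^ beta)%:E)%E.
  rewrite -fD; exact: (karlin_odd_diffD hP' hbeta (mA x) (mA y) (muoo x) (muoo y) Doo).
have k_ge0 X : (0 <= kappa X)%E by exact: karlin_measure_ge0.
have k0oo : (kappa (Ox `\` Oy) < +oo)%E.
  by rewrite (le_lt_trans _ (ltry (mdist x y `^ beta)))// -kD leeDl.
have k1oo : (kappa (Oy `\` Ox) < +oo)%E.
  by rewrite (le_lt_trans _ (ltry (mdist x y `^ beta)))// -kD leeDr.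
have kappa0 : kappa set0 = 0%E.
  rewrite /kappa /karlin_measure integral0_eq ?mule0// => r _.
  by rewrite measure0 mule0.
(* Stated for a generic pair, to be used for x and for y with the roles of the two events
   exchanged. *)
have split_eta z (Oz Ow : set (pmspace E R)) : measurable Oz -> measurable Ow ->
    Oz = odd_at (A z) ->
    {ae P, forall w, eta z w = Mab (Oz `\` Ow) w + Mab (Oz `&` Ow) w}.
  move=> mz mw Oz_def.
  have OzE : Oz = (Oz `\` Ow) `|` (Oz `&` Ow) by rewrite setUC setUIDK.
  have koo : (kappa (Oz `\` Ow `|` Oz `&` Ow) < +oo)%E.
    by rewrite -OzE Oz_def /kappa (karlin_odd_at hP' hbeta (mA z) (muoo z)) ltry.
  have dis : (Oz `\` Ow) `&` (Oz `&` Ow) = set0.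
    by apply/seteqP; split => m //= [[_ nOw] [_ /nOw]].
  have := SaS_rm_setU hMab kappa0 (measurableD mz mw) (measurableI _ _ mz mw)
    dis koo.
  by apply: filterS => w <-; rewrite -OzE Oz_def.
pose X (i : 'I_2) := Mab (if i == ord0 then Ox `\` Oy else Oy `\` Ox).
have indX : independent_family P (fun i => X i : Omega -> R).
  apply: (SaS_rm_independent hMab) => [i|i|]; try by case: ifP => _ //; exact: measurableD.
  apply/trivIsetP => -[[|[|//]] i2] [[|[|//]] j2] _ _ //= _.
    by apply/seteqP; split => m //= [[_ nOy] [/nOy]].
  by apply/seteqP; split => m //= [[_ nOx] [/nOx]].
have X0 : SaS_law alpha (fine (kappa (Ox `\` Oy)) `^ alpha^-1) (distribution P (X ord0)).
  exact: (SaS_rm_law hMab (measurableD mOx mOy) k0oo).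
have X1 : SaS_law alpha (fine (kappa (Oy `\` Ox)) `^ alpha^-1) (distribution P (X ord_max)).
  exact: (SaS_rm_law hMab (measurableD mOy mOx) k1oo).
set k := (mdist x y `^ (beta / alpha))^-1.
have k0 : 0 < k by rewrite invr_gt0 powR_gt0.
(* Raising to the power [alpha] undoes the exponents 1 / alpha: the left side becomes d(x, y)^beta
   and the right side the sum in [kD]. *)
have sE : (mdist x y `^ (beta / alpha)) `^ alpha =
    (fine (kappa (Ox `\` Oy)) `^ alpha^-1) `^ alpha +
    (fine (kappa (Oy `\` Ox)) `^ alpha^-1) `^ alpha.
  rewrite -!powRrM mulfVK ?gt_eqF// mulVf ?gt_eqF// !powRr1 ?fine_ge0//.
  by rewrite -fineD ?ge0_fin_numE// kD.
have := SaS_law_scale k0 (powR_ge0 _ _) (SaS_law_sub indX X0 X1 sE).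
(* The scale d(x, y)^(beta / alpha) of the difference times its inverse [k] is 1. *)
rewrite divff ?gt_eqF ?powR_gt0//.
apply: SaS_law_ae.
(* Almost surely both values contain the same term, the random measure of the intersection of [Ox]
   and [Oy], which cancels in the difference. *)
apply: filterS2 (split_eta x Ox Oy mOx mOy erefl) (split_eta y Oy Ox mOy mOx erefl).
move=> w /= -> ->; rewrite /X/=.
by congr (_ * _); rewrite setIC opprD addrACA subrr addr0.
Qed.
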